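(* Let $\mathcal H$ be a non-empty hypergraph on vertex set $[r]$, all of whose edges have size at least $2$. Let $\mathcal F_1,\dots,\mathcal F_r\subseteq 2^{[n]}$, and suppose that $$0\le p\le\min_{E\in\mathcal H}\frac{|E|-1}{|E|}.$$ Suppose that for every edge $E\in\mathcal H$, the subcollection $\{\mathcal F_i: i\in E\}$ is $|E|$-cross-intersecting. Define $$\tau(\mathcal H):=\min\left\{\sum_{i=1}^r a_i:\ a_i\ge 0\text{ for all }i\in[r],\ \sum_{i\in E}a_i\ge |E|\text{ for every }E\in\mathcal H\right\}.$$ Then $$\prod_{i=1}^r\mu_p(\mathcal F_i)\le p^{\tau(\mathcal H)}.$$
   Context: $[n]=\{1,\dots,n\}$ and $2^{[n]}$ is its power set. A hypergraph $\mathcal H$ on $[r]$ is identified with its set of edges, a set of subsets of $[r]$; non-empty means it has at least one edge. For $0\le p\le 1$ and $\mathcal F\subseteq 2^{[n]}$, the $p$-biased measure is $\mu_p(\mathcal F)=\sum_{F\in\mathcal F}p^{|F|}(1-p)^{n-|F|}$, with the convention $0^0=1$. An indexed subcollection $\{\mathcal F_i:i\in E\}$ is $|E|$-cross-intersecting if $\bigcap_{i\in E}A_i\neq\varnothing$ for every choice of $A_i\in\mathcal F_i$, $i\in E$ (vacuously true if some $\mathcal F_i$ with $i\in E$ is empty). The minimum in $\tau(\mathcal H)$ is over real vectors $(a_1,\dots,a_r)$. *)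

(* Defs.v *)
From HB Require Import structures.
From mathcomp Require Import all_boot all_order all_algebra.
From mathcomp Require Import all_classical all_reals all_analysis.
Import Order.TTheory GRing.Theory Num.Theory numFieldNormedType.Exports.

Set Implicit Arguments.
Unset Strict Implicit.
Unset Printing Implicit Defensive.

Local Open Scope ring_scope.

Definition mu (R : realType) (n : nat) (p : R) (F : {set {set 'I_n}}) : R :=
  \sum_(A in F) p ^+ #|A| * (1 - p) ^+ (n - #|A|).

(* The choice [A] is total on the index type, but only its values on [E]
   matter. *)
Definition cross_intersecting (n r : nat) (F : 'I_r -> {set {set 'I_n}})
    (E : {set 'I_r}) : Prop :=
  forall A : 'I_r -> {set 'I_n},
    (forall i, i \in E -> A i \in F i) -> \bigcap_(i in E) A i != finset.set0.

Definition feasible (R : realType) (r : nat) (H : {set {set 'I_r}})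
    (a : 'rV[R]_r) : Prop :=
  (forall i, 0 <= a ord0 i) /\
  (forall E, E \in H -> #|E|%:R <= \sum_(i in E) a ord0 i).

(* The infimum is a minimum: see [tau_attained] and [tau_le]. *)
Definition tau (R : realType) (r : nat) (H : {set {set 'I_r}}) : R :=
  inf [set \sum_i a ord0 i | a in feasible (R := R) H]%classic.

Section TauMin.
Local Open Scope classical_set_scope.
Variables (R : realType) (r : nat) (H : {set {set 'I_r}}).

Let sum_continuous (P : pred 'I_r) :
  continuous (fun a : 'rV[R]_r => \sum_(i | P i) a ord0 i).
Proof.
apply: continuous_big => [|i _]; first exact: add_continuous.
exact: coord_continuous.
Qed.

Lemma feasible_min : exists2 c : 'rV[R]_r, feasible H c &
  forall a, feasible H a -> \sum_i c ord0 i <= \sum_i a ord0 i.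
Proof.
pose box := [set v : 'rV[R]_r | forall i, `[0, r%:R] (v ord0 i)].
pose cov := \bigcap_(E in [set E | E \in H])
  (fun a : 'rV[R]_r => \sum_(i in E) a ord0 i) @^-1` [set x | #|E|%:R <= x].
have cbox : compact box.
  by apply: (@rV_compact R _ (fun=> `[0, r%:R])) => i; exact: segment_compact.
have ccov : closed cov.
  apply: closed_bigI => E _; apply: preimage_closed; last exact: closed_ge.
  by move=> a _; exact: sum_continuous.
have one_box : (box `&` cov) (const_mx 1).
  split=> [i|E _] /=.
    by rewrite mxE in_itv /= ler01 (ler_nat _ 1) (leq_ltn_trans _ (ltn_ord i)).
  by under eq_bigr do rewrite mxE; rewrite sumr_const.
have cA := compact_closedI cbox ccov.
have [||c] := @EVT_min_rV R r (fun a => \sum_i a ord0 i) (box `&` cov) _ cA.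
- by exists (const_mx 1).
- by apply: continuous_subspaceT => a; exact: sum_continuous.
rewrite inE => -[cb cc] cmin; exists c.
  by split=> [i|E EH]; [have /itvP := cb i => -> | exact: (cc E EH)].
move=> a [a0 acov].
have [le_r|/ltW ge_r] := leP (\sum_i a ord0 i) r%:R.
  apply: cmin; rewrite inE; split=> [i|E EH]; last exact: acov.
  rewrite /= in_itv /= a0 (le_trans _ le_r)// (bigD1 i)//= lerDl.
  exact: sumr_ge0.
apply: le_trans ge_r; apply: (le_trans (cmin (const_mx 1) _)); first by rewrite inE.
by under eq_bigr do rewrite mxE; rewrite sumr_const card_ord.
Qed.

Lemma tau_le (a : 'rV[R]_r) : feasible H a -> tau R H <= \sum_i a ord0 i.
Proof.
move=> fa; apply: ge_inf; last by exists a.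
by exists 0 => _ [b [b0 _] <-]; exact: sumr_ge0.
Qed.

Lemma tau_attained : exists2 c : 'rV[R]_r, feasible H c &
  tau R H = \sum_i c ord0 i.
Proof.
have [c fc cmin] := feasible_min; exists c => //.
apply/eqP; rewrite eq_le tau_le//=; apply: lb_le_inf.
  by exists (\sum_i c ord0 i), c.
by move=> _ [b fb <-]; exact: cmin.
Qed.

End TauMin.

(* Main.v *)
(* Everything reduces to a single edge: once [prod_(i in E) mu_p(F_i) <= p^#|E|]
   is known for each edge [E], the numbers [a_i = log_p mu_p(F_i)] form a
   feasible vector, so their sum is at least [tau]. No LP duality is needed; if
   some [mu_p(F_i)] vanishes (in particular if [p = 0]), there is nothing to
   prove.

   For one edge of size [k], put [q = 1 - 1/k] and pass to up-closures. A random
   map from the points to the edge couples the families and gives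
   [sum mu_q(F_i) <= k - 1], hence [prod mu_q(F_i) <= q^k] by AM-GM. The bound
   descends from [q] to [p = q^s], [s >= 1], because [mu_(q^s)(F) <= mu_q(F)^s]
   for up-closed [F], by induction on the points and convexity of [x^s]. *)
Require Import Defs.
From mathcomp Require Import all_boot all_order all_algebra.
From mathcomp Require Import all_classical all_reals all_analysis.
From mathcomp Require Import ring lra.
Import Order.TTheory GRing.Theory Num.Theory.
Set Implicit Arguments.
Unset Strict Implicit.
Unset Printing Implicit Defensive.
Local Open Scope ring_scope.

(** Both [a + c] and [b] are convex combinations of [a] and [b + c], with weights [t] and [1 - t]
    interchanged; adding the two convexity inequalities gives the bound. *)
Lemma powR_increment_le (R : realType) (s a b c : R) :
  1 <= s -> 0 <= a -> a <= b -> 0 <= c ->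
  (a + c) `^ s + b `^ s <= a `^ s + (b + c) `^ s.
Proof.
move=> s1 a0 ab c0; have [D0|D0] := eqVneq (b - a + c) 0.
  have -> : b = a by lra.
  have -> : c = 0 by lra.
  by rewrite addr0.
have D_gt0 : 0 < b - a + c by rewrite lt_neqAle eq_sym D0/=; lra.
pose t := c / (b - a + c).
have tD : t * (b - a + c) = c by rewrite /t divfK.
have t0 : 0 <= t by rewrite divr_ge0 // ltW.
have t1 : t <= 1 by rewrite ler_pdivrMr // mul1r; lra.
have cvx x y : 0 <= x -> 0 <= y ->
    (t * x + (1 - t) * y) `^ s <= t * x `^ s + (1 - t) * y `^ s.
  by move=> x0 y0; apply: (convex_powR s1 (Itv01 t0 t1));
    rewrite inE/= in_itv/= andbT.
have bc0 : 0 <= b + c by lra.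
have := cvx _ _ a0 bc0; have := cvx _ _ bc0 a0.
have -> : t * (b + c) + (1 - t) * a = a + c by lra.
have -> : t * a + (1 - t) * (b + c) = b by lra.
by lra.
Qed.

(** * Biased measures on subcubes and change of the parameter *)

Section SubcubeMeasure.
Variables (R : realType) (T : finType).
Implicit Types (p q s : R) (S : {set T}) (F : {set {set T}}).

(** Restricting to subsets of [S] allows induction on the points while the ambient type stays
    fixed. *)
Definition mu_sub p S F : R :=
  \sum_(A in F | A \subset S) p ^+ #|A| * (1 - p) ^+ (#|S| - #|A|).

Definition up_closed F := forall A B : {set T}, A \subset B -> A \in F -> B \in F.

(** Members of [F] that already contain [i] are kept, so that up-closedness is inherited; the link
    is measured only on sets [S] that avoid [i]. *)
Definition link (i : T) F : {set {set T}} := [set A | i |: A \in F].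

Lemma up_closed_link i F : up_closed F -> up_closed (link i F).
Proof. by move=> upF A B AB; rewrite !inE; apply: upF; apply: finset.setUS. Qed.

Lemma sub_link i F : up_closed F -> F \subset link i F.
Proof.
move=> upF; apply/fintype.subsetP => A AF; rewrite inE.
by apply: (upF A) => //; apply: finset.subsetUr.
Qed.

Lemma mu_sub0 p F : mu_sub p finset.set0 F = (finset.set0 \in F)%:R.
Proof.
rewrite /mu_sub big_mkcondl (big_pred1 finset.set0) /=; last first.
  by move=> A; rewrite /= finset.subset0.
by rewrite cards0 subnn !expr0 mulr1; case: ifP.
Qed.

(** Condition on whether the random set contains [i]. *)
Lemma mu_subU1 p i S F : i \notin S ->
  mu_sub p (i |: S) F = (1 - p) * mu_sub p S F + p * mu_sub p S (link i F).
Proof.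
move=> iS; rewrite /mu_sub (bigID (fun A : {set T} => i \in A)) /= addrC.
congr (_ + _).
  rewrite big_distrr /=; apply: eq_big => [A|A /andP[/andP[_ AS] iA]].
    rewrite -andbA; congr (_ && _); apply/andP/idP => [[AS iA]|AS].
      by rewrite -(finset.setU1K iS) finset.subsetD1 AS.
    split; first exact: fintype.subset_trans AS (finset.subsetUr _ _).
    by apply: contra iS; apply: (fintype.subsetP AS).
  have {}AS : A \subset S by rewrite -(finset.setU1K iS) finset.subsetD1 AS.
  by rewrite cardsU1 iS add1n subSn ?subset_leq_card// exprS; ring.
rewrite (reindex_onto (fun A => i |: A) (fun A => A :\ i)) /=; last first.
  by move=> A /andP[_ iA]; rewrite finset.setD1K.
rewrite big_distrr /=; apply: eq_big => [A|A].
  rewrite finset.setU11 andbT -andbA inE; congr (_ && _).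
  apply/andP/idP => [[AS /eqP <-]|AS].
    by rewrite finset.subDset.
  have iA : i \notin A by apply: contra iS; apply: (fintype.subsetP AS).
  by rewrite finset.setUS // finset.setU1K.
move=> /andP[_ /eqP AE].
have iA : i \notin A by rewrite -AE !inE eqxx.
by rewrite !cardsU1 iS iA !add1n subSS exprS mulrA.
Qed.

Lemma mu_sub_ge0 p S F : 0 <= p -> p <= 1 -> 0 <= mu_sub p S F.
Proof.
by move=> p0 p1; apply: sumr_ge0 => A _; rewrite mulr_ge0 ?exprn_ge0 ?subr_ge0.
Qed.

Lemma mu_subS p S F F' : 0 <= p -> p <= 1 -> F \subset F' ->
  mu_sub p S F <= mu_sub p S F'.
Proof.
move=> p0 p1 /fintype.subsetP FF'; rewrite /mu_sub !(big_mkcond (fun A => _ && _)).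
apply: ler_sum => A _ /=; case AF: (A \in F) => /=; first by rewrite FF'.
by case: ifP => _ //; rewrite mulr_ge0 ?exprn_ge0 ?subr_ge0.
Qed.

Lemma finset_setU1_ind (P : {set T} -> Prop) : P finset.set0 ->
  (forall i S, i \notin S -> P S -> P (i |: S)) -> forall S, P S.
Proof.
move=> P0 PU S; have [k] := ubnP #|S|; elim: k S => // k IH S Sk.
have [->//|[i iS]] := finset.set_0Vmem S.
rewrite -(finset.setD1K iS); apply: PU; first by rewrite !inE eqxx.
by apply: IH; move: Sk; rewrite (cardsD1 i) iS.
Qed.

Lemma mu_sub_le1 p S F : 0 <= p -> p <= 1 -> mu_sub p S F <= 1.
Proof.
move=> p0 p1; elim/finset_setU1_ind: S F => [|i S iS IH] F.
  by rewrite mu_sub0; case: (_ \in _); rewrite ?ler01.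
rewrite mu_subU1 //; have := IH F; have := IH (link i F); nra.
Qed.

Lemma mu_sub_powR q s S F : 0 <= q -> q <= 1 -> 1 <= s -> up_closed F ->
  mu_sub (q `^ s) S F <= mu_sub q S F `^ s.
Proof.
move=> q0 q1 s1; have s0 : 0 < s by apply: lt_le_trans s1.
have qs0 : 0 <= q `^ s by apply: powR_ge0.
have qs1 : q `^ s <= 1.
  have -> : 1 = 1 `^ s :> R by rewrite powR1.
  by apply: ge0_ler_powR; rewrite ?nnegrE // ltW.
elim/finset_setU1_ind: S F => [|i S iS IH] F upF.
  by rewrite !mu_sub0; case: (_ \in _); rewrite ?powR1 ?powR0 // gt_eqF.
rewrite !mu_subU1 //.
have := IH _ upF; have := IH _ (up_closed_link (i := i) upF).
have := mu_subS S q0 q1 (sub_link i upF); have := mu_sub_ge0 S F q0 q1.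
move: (mu_sub q S F) (mu_sub q S (link i F)) => x y x0 xy ys xs.
have qx : 0 <= (1 - q) * x by apply: mulr_ge0; rewrite ?subr_ge0.
(* Take [a = q * x], [b = q * y], [c = (1 - q) * x], so that [a + c = x]; [a <= b] because an
   up-closed family lies in its link. *)
have := powR_increment_le s1 (mulr_ge0 q0 x0) (ler_wpM2l q0 xy) qx.
have -> : q * x + (1 - q) * x = x by ring.
rewrite !powRM // ?(le_trans x0 xy) //.
rewrite [q * y + _]addrC => inc.
have := ler_wpM2l qs0 ys.
have : (1 - q `^ s) * mu_sub (q `^ s) S F <= (1 - q `^ s) * x `^ s.
  by rewrite ler_wpM2l ?subr_ge0.
lra.
Qed.

End SubcubeMeasure.

(** * Cross-intersecting families and random maps to an edge *)

Section CrossIntersecting.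
Variables (R : realType) (n r : nat).
Implicit Types (p q : R) (G : {set {set 'I_n}}) (F : 'I_r -> {set {set 'I_n}})
  (E : {set 'I_r}).

Lemma mu_mu_sub p G : mu p G = mu_sub p finset.setT G.
Proof.
apply: eq_big => [A|A _]; first by rewrite finset.subsetT andbT.
by rewrite cardsT card_ord.
Qed.

Definition up_closure G : {set {set 'I_n}} :=
  [set B : {set _} | [exists A in G, A \subset B]].

Lemma up_closed_closure G : up_closed (up_closure G).
Proof.
move=> A B AB; rewrite !inE => /exists_inP[C CG CA].
by apply/exists_inP; exists C => //; apply: fintype.subset_trans AB.
Qed.

Lemma sub_up_closure G : G \subset up_closure G.
Proof. by apply/fintype.subsetP => A AG; rewrite inE; apply/exists_inP; exists A. Qed.

Lemma cross_intersecting_up_closure F E :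
  cross_intersecting F E -> cross_intersecting (up_closure \o F) E.
Proof.
move=> FE B BF.
have /choice[A AP] i : exists A, i \in E -> A \in F i /\ A \subset B i.
  (* The choice must be total; outside [E] the empty set serves as a default. *)
  have [iE|iE] := boolP (i \in E); last by exists finset.set0.
  have := BF i iE; rewrite inE => /exists_inP[A AF AB].
  by exists A.
have [x xA] := finset.set0Pn _ (FE A (fun i iE => (AP i iE).1)).
apply/finset.set0Pn; exists x; apply/finset.bigcapP => i iE.
by apply: (fintype.subsetP (AP i iE).2); move/finset.bigcapP: xA; apply.
Qed.

(** Such a map equals [i] off [A] and is arbitrary with values in [E :\ i] on [A]: a partial
    function with default value [i]. *)
Lemma card_avoid E i (A : {set 'I_n}) : i \in E ->
  #|[set g in ffun_on E | [set x | g x != i] == A]| = (#|E|.-1 ^ #|A|)%N.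
Proof.
move=> iE; rewrite (cardsD1 i E) iE add1n /= -(card_pffun_on i).
apply: eq_card => g; rewrite inE; apply/andP/pffun_onP => [[/ffun_onP gE /eqP <-]|[sg gA]].
  split; first by apply/fintype.subsetP => x; rewrite !inE.
  by move=> _ /mapP[x + ->]; rewrite mem_enum !inE gE andbT.
have gAE x : x \in A -> g x \in E :\ i.
  by move=> xA; apply: gA; apply: map_f; rewrite mem_enum.
have gnA x : x \notin A -> g x = i.
  by move=> xA; apply/eqP; apply: contraNT xA => gx; apply: (fintype.subsetP sg).
split.
  apply/ffun_onP => x; have [/gAE|/gnA->//] := boolP (x \in A).
  by rewrite inE => /andP[].
apply/eqP/finset.setP => x; rewrite inE; have [/gAE|/gnA->] := boolP (x \in A).
  by rewrite !inE => /andP[].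
by rewrite eqxx.
Qed.

(** Sort the maps by the set they produce. With [k = #|E|], each [A] in [G] arises from
    [(k - 1) ^ #|A|] maps, which is [k ^ n] times its weight at parameter [1 - 1 / k]. *)
Lemma card_avoid_mem E i G : i \in E -> (0 < #|E|)%N ->
  #|[set g in ffun_on E | [set x | g x != i] \in G]|%:R =
  #|E|%:R ^+ n * mu ((#|E|%:R - 1) / #|E|%:R : R) G.
Proof.
move=> iE E0; have k0 : #|E|%:R != 0 :> R by rewrite pnatr_eq0 -lt0n.
have -> : #|[set g in ffun_on E | [set x | g x != i] \in G]| =
    (\sum_(A in G) #|[set g in ffun_on E | [set x | g x != i] == A]|)%N.
  rewrite -sum1_card (partition_big (fun g : {ffun _ -> _} => [set x | g x != i]) (mem G)) /=.
    apply: eq_bigr => A AG; rewrite sum1_card; apply: eq_card => g.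
    rewrite !inE unfold_in /= inE -andbA; congr (_ && _).
    by case: eqP => [->|]; rewrite ?AG ?andbF.
  by move=> g; rewrite inE => /andP[].
rewrite natr_sum big_distrr /=; apply: eq_bigr => A _.
rewrite card_avoid // natrX -subn1 natrB //.
have An : (#|A| <= n)%N by rewrite -[X in (_ <= X)%N]card_ord max_card.
have -> : 1 - (#|E|%:R - 1) / #|E|%:R = #|E|%:R^-1 :> R by field.
have -> : #|E|%:R ^+ n = #|E|%:R ^+ (n - #|A|) * #|E|%:R ^+ #|A| :> R.
  by rewrite -exprD subnK.
rewrite exprVn expr_div_n.
by field; rewrite !expf_neq0.
Qed.

(* For a uniform random map [g] from the points to [E], each set
   [{x | g x != i}] has the biased measure of parameter [1 - 1 / #|E|], and
   these sets have empty common intersection over [i] in [E], so at most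
   [#|E| - 1] of them belong to their family. *)
Lemma sum_mu_le F E : cross_intersecting F E -> (0 < #|E|)%N ->
  \sum_(i in E) mu ((#|E|%:R - 1) / #|E|%:R : R) (F i) <= #|E|%:R - 1.
Proof.
move=> FE E0; have k0 : 0 < #|E|%:R ^+ n :> R by rewrite exprn_gt0 // ltr0n.
rewrite -(ler_pM2l k0) big_distrr /=.
under eq_bigr => i iE do rewrite -(card_avoid_mem _ iE) //.
have -> : #|E|%:R ^+ n * (#|E|%:R - 1) = (#|E| ^ n * #|E|.-1)%:R :> R.
  by rewrite natrM natrX -subn1 natrB.
rewrite -natr_sum ler_nat.
under eq_bigr => i _ do rewrite -sum1_card big_mkcond /=.
(* Double counting: it remains to see that each map into [E] is counted for at most [#|E| - 1]
   indices. *)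
rewrite exchange_big /=.
rewrite -[X in (X ^ n)%N]/(#|mem E|) -[X in (_ ^ X)%N]card_ord -card_ffun_on.
rewrite -sum_nat_const big_mkcond [leqRHS]big_mkcond /=; apply: leq_sum => g _.
have [gE|gE] := boolP (g \in ffun_on E); last first.
  by rewrite big1 // => i _; rewrite inE (negbTE gE).
rewrite -ltnS prednK //.
have [i iE iF] : exists2 i, i \in E & [set x | g x != i] \notin F i.
  apply/exists_inP; apply: contraT; rewrite negb_exists_in => /forall_inP h.
  have /finset.set0Pn[x] := FE (fun i => [set x | g x != i])
    (fun i iE => negPn (h i iE)).
  (* A common point [x] would lie in the set of index [g x], which omits it. *)
  move/finset.bigcapP => /(_ (g x) (ffun_onP gE x)); by rewrite inE eqxx.
rewrite (bigD1 i) //= inE (negbTE iF) andbF add0n.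
rewrite [X in (_ < X)%N](cardsD1 i) iE add1n ltnS -sum1_card.
rewrite [leqRHS](eq_bigl (fun j => (j \in E) && (j != i))); last first.
  by move=> j; rewrite !inE andbC.
by apply: leq_sum => j _; case: ifP.
Qed.

(** With [p = q ^ s] and [k = #|E|], the product at [p] is at most the [s]-th power of the product
    at [q] for the up-closures, hence at most [(q ^ k) ^ s = p ^ k]. *)
Lemma prod_mu_edge_le F E p : (2 <= #|E|)%N -> 0 < p ->
  p <= (#|E|%:R - 1) / #|E|%:R -> cross_intersecting F E ->
  \prod_(i in E) mu p (F i) <= p ^+ #|E|.
Proof.
move=> E2 p0 pq FE; have E0 : (0 < #|E|)%N by apply: ltn_trans E2.
have k0 : 0 < #|E|%:R :> R by rewrite ltr0n.
move: pq; set q := (_ / _) => pq.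
have q0 : 0 < q by apply: lt_le_trans pq.
have q1 : q < 1 by rewrite ltr_pdivrMr // mul1r; lra.
have p1 : p < 1 by apply: le_lt_trans q1.
have lq : ln q < 0 by rewrite ln_lt0 // q0 q1.
have lpq : ln p <= ln q by rewrite ler_ln.
pose s := ln p / ln q.
have s1 : 1 <= s by rewrite ler_ndivlMr // mul1r.
have ps : p = q `^ s by rewrite /powR gt_eqF // /s divfK ?lt_eqF // lnK.
pose F' := up_closure \o F.
have mu0 i : 0 <= mu q (F' i) by rewrite mu_mu_sub mu_sub_ge0 // ltW.
apply: (@le_trans _ _ (\prod_(i in E) mu q (F' i) `^ s)).
  apply: ler_prod => i _; rewrite !mu_mu_sub mu_sub_ge0 ?(ltW p0) ?(ltW p1) //=.
  apply: le_trans (mu_subS _ (ltW p0) (ltW p1) (sub_up_closure (F i))) _.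
  by rewrite {1}ps mu_sub_powR ?(ltW q0) ?(ltW q1) //; apply: up_closed_closure.
(* Nonnegativity is carried along because splitting a real power of a product requires it. *)
have [-> _] : \prod_(i in E) mu q (F' i) `^ s = (\prod_(i in E) mu q (F' i)) `^ s
    /\ 0 <= \prod_(i in E) mu q (F' i).
  apply: (big_rec2 (fun x y => x = y `^ s /\ 0 <= y)).
  - by rewrite powR1.
  - by move=> i _ y _ [-> y0]; rewrite powRM // mulr_ge0.
rewrite ps -powR_mulrn ?powR_ge0 // powRAC powR_mulrn; last exact: ltW.
(* The mean of the measures is at most [(#|E| - 1) / #|E| = q], which is what AM-GM needs. *)
have qE : \sum_(i in E) mu q (F' i) / #|E|%:R <= q.
  rewrite -big_distrl ler_pM2r ?invr_gt0 //=.
  by apply: sum_mu_le => //; apply: cross_intersecting_up_closure.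
apply: ge0_ler_powR; rewrite ?nnegrE ?prodr_ge0 ?exprn_ge0 ?(ltW q0) //.
  by apply: le_trans s1.
apply: le_trans (leif_AGM (fun i _ => mu0 i)) _.
by rewrite big_distrl lerXn2r ?nnegrE ?(ltW q0) //= sumr_ge0 // => i _;
  rewrite divr_ge0.
Qed.

End CrossIntersecting.

(** * From single edges to the hypergraph by taking logarithms *)

Theorem theorem5p4 (R : realType) (r n : nat) (H : {set {set 'I_r}})
    (F : 'I_r -> {set {set 'I_n}}) (p : R)
    (H_neq0 : H != finset.set0)
    (H_ge2 : forall E, E \in H -> (2 <= #|E|)%N)
    (p_ge0 : 0 <= p)
    (p_le : forall E, E \in H -> p <= (#|E|%:R - 1) / #|E|%:R)
    (F_cross : forall E, E \in H -> cross_intersecting F E) :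
  \prod_(i < r) mu p (F i) <= p `^ tau R H.
Proof.
have [E0 E0H] := finset.set0Pn _ H_neq0.
have k0 : 0 < #|E0|%:R :> R by rewrite ltr0n (ltn_trans _ (H_ge2 _ E0H)).
have p1 : p < 1.
  by apply: le_lt_trans (p_le _ E0H) _; rewrite ltr_pdivrMr // mul1r; lra.
have [/existsP[i /eqP mui]|/existsPn mu_neq0] := boolP [exists i, mu p (F i) == 0].
  by rewrite (bigD1 i) //= mui mul0r powR_ge0.
have mu_gt0 i : 0 < mu p (F i).
  by rewrite lt_neqAle eq_sym mu_neq0 mu_mu_sub mu_sub_ge0 // ltW.
have p_gt0 : 0 < p.
  (* At [p = 0] all the mass sits on the empty set, so nonzero measures put it in every family,
     against cross-intersection on [E0]. *)
  rewrite lt_neqAle p_ge0 andbT; apply/eqP => p0.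
  have F0 i : finset.set0 \in F i.
    apply: contraNT (mu_neq0 i) => F0; rewrite -p0 /mu big1 // => A AF.
    rewrite expr0n cards_eq0; case: eqP => [A0|]; last by rewrite mul0r.
    by rewrite -A0 AF in F0.
  have /finset.set0Pn[x /finset.bigcapP xE] :=
    F_cross _ E0H (fun=> finset.set0) (fun i _ => F0 i).
  have /finset.set0Pn[i /xE] : E0 != finset.set0.
    by rewrite -card_gt0 (ltn_trans _ (H_ge2 _ E0H)).
  by rewrite inE.
have lp : ln p < 0 by rewrite ln_lt0 // p_gt0.
pose a : 'rV[R]_r := \row_i (ln (mu p (F i)) / ln p).
have muE i : mu p (F i) = p `^ a ord0 i.
  by rewrite mxE /powR gt_eqF // divfK ?lt_eqF // lnK ?posrE.
(* A general [P] covers both the full product and the product over one edge. *)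
have prodE (P : pred 'I_r) :
    \prod_(i | P i) mu p (F i) = p `^ (\sum_(i | P i) a ord0 i).
  apply: (big_rec2 (fun x y => x = p `^ y)); first by rewrite powRr0.
  by move=> i x y _ ->; rewrite muE powRD // (gt_eqF p_gt0) implybT.
(* Since [ln p < 0], passing to exponents reverses inequalities. *)
have powR_le x y : (p `^ x <= p `^ y) = (y <= x).
  rewrite /powR gt_eqF // ler_expR ler_nM2r //.
rewrite prodE powR_le; apply: tau_le; split=> [i|E EH].
  (* Nonnegativity of [a] amounts to the measures being at most 1. *)
  rewrite mxE ler_ndivlMr // mul0r ln_le0 //.
  by rewrite mu_mu_sub mu_sub_le1 // ltW.
(* The covering constraint at [E], exponentiated to base [p], is the bound for a single edge. *)
rewrite -powR_le -prodE powR_mulrn //.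
by apply: prod_mu_edge_le; [exact: H_ge2| |exact: p_le|exact: F_cross].
Qed.
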